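(* Let $\mathcal{R}$ be a commutative ring with unity, let $\mathcal{A}$ and $\mathcal{B}$ be $\mathcal{R}$-algebras, let $\mathcal{M}$ be an $(\mathcal{A},\mathcal{B})$-bimodule, and let $\mathcal{T}=Tri(\mathcal{A},\mathcal{M},\mathcal{B})$ be the associated triangular algebra. Suppose that $l.ann_{\mathcal{A}}\mathcal{M}=\{0\}$, that $\mathcal{B}$ is a SLIP algebra, and that every local left multiplier from $\mathcal{B}$ into $\mathcal{M}$ is a left multiplier. Then $\mathcal{T}$ is a SLIP algebra.
   Context: All algebras are associative $\mathcal{R}$-algebras with unity $1$ and all modules and bimodules are unital; modules over an $\mathcal{R}$-algebra are $\mathcal{R}$-modules in the compatible way (for bimodules, $rm=mr$ for $r\in\mathcal{R}$). The triangular algebra $Tri(\mathcal{A},\mathcal{M},\mathcal{B})$ is the algebra of all matrices $\begin{pmatrix} a & m\\ 0 & b\end{pmatrix}$ with $a\in\mathcal{A}$, $b\in\mathcal{B}$, $m\in\mathcal{M}$, under the usual matrix operations. For a left $\mathcal{A}$-module $\mathcal{M}$, $l.ann_{\mathcal{A}}\mathcal{M}=\{a\in\mathcal{A}: a\mathcal{M}=\{0\}\}$. For an algebra $\mathcal{C}$ and a right $\mathcal{C}$-module $\mathcal{X}$, an $\mathcal{R}$-linear map $\psi:\mathcal{C}\to\mathcal{X}$ is a left multiplier if $\psi(c)=\psi(1)c$ for all $c\in\mathcal{C}$; it is a local left multiplier if for each $c\in\mathcal{C}$ there exists $x_c\in\mathcal{X}$ with $\psi(c)=x_c c$. An $\mathcal{R}$-linear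 map $\psi:\mathcal{C}\to\mathcal{C}$ is LIP (left-ideal-preserving) if $\psi(\mathcal{J})\subseteq\mathcal{J}$ for every left ideal $\mathcal{J}$ of $\mathcal{C}$ (equivalently, $\psi$ is a local left multiplier from $\mathcal{C}$ to $\mathcal{C}$). The algebra $\mathcal{C}$ is SLIP if every LIP map on $\mathcal{C}$ is a left multiplier. *)

(* Defs.v *)
From HB Require Import structures.
From mathcomp Require Import all_boot all_algebra.

Set Implicit Arguments.
Unset Strict Implicit.
Unset Printing Implicit Defensive.

Import GRing.Theory.

Local Open Scope ring_scope.

(* Unital associative R-algebras, the zero algebra included: the library's
   algType requires 1 != 0.  Hierarchy Builder cannot join pzRingType and
   lmodType below algType, whence the hand-packed record. *)
Record pzAlgType (R : comPzRingType) := PzAlg {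
  pzAlg_ring : pzRingType;
  pzAlg_scale : R -> pzAlg_ring -> pzAlg_ring;
  pzAlg_scaleA : forall (r s : R) (x : pzAlg_ring),
    pzAlg_scale r (pzAlg_scale s x) = pzAlg_scale (r * s) x;
  pzAlg_scale1 : left_id 1 pzAlg_scale;
  pzAlg_scaleDr : right_distributive pzAlg_scale +%R;
  pzAlg_scaleDl : forall x : pzAlg_ring,
    {morph pzAlg_scale^~ x : r s / r + s};
  pzAlg_scaleAl : forall (r : R) (x y : pzAlg_ring),
    pzAlg_scale r (x * y) = pzAlg_scale r x * y;
  pzAlg_scaleAr : forall (r : R) (x y : pzAlg_ring),
    pzAlg_scale r (x * y) = x * pzAlg_scale r y
}.

(* The carrier, as a head symbol on which both the ring and the module
   structure can be inferred. *)
Definition pzAlg_sort (R : comPzRingType) (A : pzAlgType R) : Type :=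
  pzAlg_ring A.

Coercion pzAlg_sort : pzAlgType >-> Sortclass.

HB.instance Definition _ (R : comPzRingType) (A : pzAlgType R) :=
  GRing.PzRing.copy (pzAlg_sort A) (pzAlg_ring A).

HB.instance Definition _ (R : comPzRingType) (A : pzAlgType R) :=
  GRing.Zmodule_isLmodule.Build R (pzAlg_sort A)
    (@pzAlg_scaleA R A) (@pzAlg_scale1 R A)
    (@pzAlg_scaleDr R A) (@pzAlg_scaleDl R A).

Fact pz_scalerAl (R : comPzRingType) (A : pzAlgType R) (r : R) (x y : A) :
  r *: (x * y) = (r *: x) * y.
Proof. exact: pzAlg_scaleAl. Qed.

Fact pz_scalerAr (R : comPzRingType) (A : pzAlgType R) (r : R) (x y : A) :
  r *: (x * y) = x * (r *: y).
Proof. exact: pzAlg_scaleAr. Qed.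

Definition pzAlg_of_algType (R : comPzRingType) (A : algType R) : pzAlgType R :=
  PzAlg (@scalerA R A) (@scale1r R A) (@scalerDr R A)
        (fun x r s => @scalerDl R A x r s) (@scalerAl R A) (@scalerAr R A).

(* The library's lmodType over A^c cannot be used for right actions here: each
   module below carries the R-module structure and the actions on one carrier. *)
HB.mixin Record isLeftModule (R : comPzRingType) (A : pzAlgType R) M
    of GRing.Lmodule R M := {
  lact : A -> M -> M;
  lactA : forall (a b : A) (m : M), lact (a * b) m = lact a (lact b m);
  lact1 : forall m : M, lact 1 m = m;
  lactDl : forall (a b : A) (m : M), lact (a + b) m = lact a m + lact b m;
  lactDr : forall (a : A) (m n : M), lact a (m + n) = lact a m + lact a n;
  lactZl : forall (r : R) (a : A) (m : M), lact (r *: a) m = r *: lact a m;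
  lactZr : forall (r : R) (a : A) (m : M), lact a (r *: m) = r *: lact a m
}.

#[short(type="leftModType")]
HB.structure Definition LeftModule (R : comPzRingType) (A : pzAlgType R) :=
  {M of GRing.Lmodule R M & isLeftModule R A M}.

HB.mixin Record isRightModule (R : comPzRingType) (B : pzAlgType R) M
    of GRing.Lmodule R M := {
  ract : M -> B -> M;
  ractA : forall (m : M) (b c : B), ract m (b * c) = ract (ract m b) c;
  ract1 : forall m : M, ract m 1 = m;
  ractDl : forall (m n : M) (b : B), ract (m + n) b = ract m b + ract n b;
  ractDr : forall (m : M) (b c : B), ract m (b + c) = ract m b + ract m c;
  ractZl : forall (r : R) (m : M) (b : B), ract (r *: m) b = r *: ract m b;
  ractZr : forall (r : R) (m : M) (b : B), ract m (r *: b) = r *: ract m b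
}.

#[short(type="rightModType")]
HB.structure Definition RightModule (R : comPzRingType) (B : pzAlgType R) :=
  {M of GRing.Lmodule R M & isRightModule R B M}.

(* r m = m r holds because both actions are compatible with the single
   R-module structure. *)
HB.mixin Record isBimodule (R : comPzRingType) (A B : pzAlgType R) M
    of LeftModule R A M & RightModule R B M := {
  lractA : forall (a : A) (m : M) (b : B),
    lact a (ract m b) = ract (lact a m : M) b
}.

#[short(type="bimodType")]
HB.structure Definition Bimodule (R : comPzRingType) (A B : pzAlgType R) :=
  {M of LeftModule R A M & RightModule R B M & isBimodule R A B M}.

Section RegularModule.
Variables (R : comPzRingType) (C : pzAlgType R).

Fact regular_mulZl (r : R) (x c : C) : (r *: x) * c = r *: (x * c).
Proof. by rewrite pz_scalerAl. Qed.

Fact regular_mulZr (r : R) (x c : C) : x * (r *: c) = r *: (x * c).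
Proof. by rewrite pz_scalerAr. Qed.

HB.instance Definition _ := isRightModule.Build R C (pzAlg_sort C)
  (@mulrA C) (@mulr1 C) (@mulrDl C) (@mulrDr C) regular_mulZl regular_mulZr.
End RegularModule.

Section Multipliers.
Variables (R : comPzRingType) (C : pzAlgType R).

Definition left_multiplier (X : rightModType C) (psi : {linear C -> X}) : Prop :=
  forall c : C, psi c = ract (psi 1) c.

Definition local_left_multiplier (X : rightModType C)
    (psi : {linear C -> X}) : Prop :=
  forall c : C, exists x : X, psi c = ract x c.

(* Closure under scalars is automatic since C is unital. *)
Definition left_ideal (J : C -> Prop) : Prop :=
  [/\ J 0,
      forall x y : C, J x -> J y -> J (x + y)
    & forall c x : C, J x -> J (c * x)].

Definition LIP (psi : {linear C -> C}) : Prop :=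
  forall J : C -> Prop, left_ideal J -> forall x : C, J x -> J (psi x).

End Multipliers.

Definition SLIP (R : comPzRingType) (C : pzAlgType R) : Prop :=
  forall psi : {linear C -> C}, LIP psi -> left_multiplier psi.

Definition l_ann (R : comPzRingType) (A : pzAlgType R) (M : leftModType A)
    (a : A) : Prop :=
  forall m : M, lact a m = 0.

(* Tri a m b is the matrix with rows (a, m) and (0, b). *)
Record tri (R : comPzRingType) (A B : pzAlgType R) (M : bimodType A B) :=
  Tri { tri_ul : A; tri_ur : M; tri_lr : B }.

Section Triangular.
Variables (R : comPzRingType) (A B : pzAlgType R) (M : bimodType A B).
Local Notation T := (tri M).
Implicit Types x y z : T.

Definition prod_of_tri x : A * M * B := (tri_ul x, tri_ur x, tri_lr x).
Definition tri_of_prod (p : A * M * B) : T := Tri p.1.1 p.1.2 p.2.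

Fact prod_of_triK : cancel prod_of_tri tri_of_prod.
Proof. by case. Qed.

HB.instance Definition _ := Choice.copy T (can_type prod_of_triK).

Definition tri0 : T := Tri 0 0 0.
Definition tri_opp x : T := Tri (- tri_ul x) (- tri_ur x) (- tri_lr x).
Definition tri_add x y : T :=
  Tri (tri_ul x + tri_ul y) (tri_ur x + tri_ur y) (tri_lr x + tri_lr y).

Fact tri_addA : associative tri_add.
Proof. by move=> x y z; congr Tri; rewrite /= addrA. Qed.

Fact tri_addC : commutative tri_add.
Proof. by move=> x y; congr Tri; rewrite /= addrC. Qed.

Fact tri_add0 : left_id tri0 tri_add.
Proof. by case=> a m b; congr Tri; rewrite /= add0r. Qed.

Fact tri_addN : left_inverse tri0 tri_opp tri_add.
Proof. by move=> x; congr Tri; rewrite /= addNr. Qed.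

HB.instance Definition _ :=
  GRing.isZmodule.Build T tri_addA tri_addC tri_add0 tri_addN.

Definition tri1 : T := Tri 1 0 1.
Definition tri_mul x y : T :=
  Tri (tri_ul x * tri_ul y)
      (lact (tri_ul x) (tri_ur y) + ract (tri_ur x) (tri_lr y))
      (tri_lr x * tri_lr y).

Fact tri_lact0 (a : A) : lact a (0 : M) = 0.
Proof. by apply: (addrI (lact a (0 : M))); rewrite -lactDr !addr0. Qed.

Fact tri_ract0 (b : B) : ract (0 : M) b = 0.
Proof. by apply: (addrI (ract (0 : M) b)); rewrite -ractDl !addr0. Qed.

Fact tri_mulA : associative tri_mul.
Proof.
move=> x y z; congr Tri; rewrite /= ?mulrA //.
by rewrite lactDr ractDl lactA ractA lractA addrA.
Qed.

Fact tri_mul1l : left_id tri1 tri_mul.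
Proof.
by case=> a m b; congr Tri; rewrite /= ?mul1r // lact1 tri_ract0 addr0.
Qed.

Fact tri_mul1r : right_id tri1 tri_mul.
Proof.
by case=> a m b; congr Tri; rewrite /= ?mulr1 // ract1 tri_lact0 add0r.
Qed.

Fact tri_mulDl : left_distributive tri_mul +%R.
Proof.
move=> x y z; congr Tri; rewrite /= ?mulrDl //.
by rewrite lactDl ractDl addrACA.
Qed.

Fact tri_mulDr : right_distributive tri_mul +%R.
Proof.
move=> x y z; congr Tri; rewrite /= ?mulrDr //.
by rewrite lactDr ractDr addrACA.
Qed.

HB.instance Definition _ := GRing.Zmodule_isPzRing.Build T
  tri_mulA tri_mul1l tri_mul1r tri_mulDl tri_mulDr.

Definition tri_scale (r : R) x : T :=
  Tri (r *: tri_ul x) (r *: tri_ur x) (r *: tri_lr x).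

Fact tri_scaleA (r s : R) x : tri_scale r (tri_scale s x) = tri_scale (r * s) x.
Proof. by congr Tri; rewrite /= scalerA. Qed.

Fact tri_scale1 : left_id 1 tri_scale.
Proof. by case=> a m b; congr Tri; rewrite /= scale1r. Qed.

Fact tri_scaleDr : right_distributive tri_scale +%R.
Proof. by move=> r x y; congr Tri; rewrite /= scalerDr. Qed.

Fact tri_scaleDl x : {morph tri_scale^~ x : r s / r + s}.
Proof. by move=> r s; congr Tri; rewrite /= scalerDl. Qed.

Fact tri_scaleAl (r : R) x y : tri_scale r (x * y) = tri_scale r x * y.
Proof.
congr Tri; rewrite /= ?pz_scalerAl //.
by rewrite scalerDr lactZl ractZl.
Qed.

Fact tri_scaleAr (r : R) x y : tri_scale r (x * y) = x * tri_scale r y.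
Proof.
congr Tri; rewrite /= ?pz_scalerAr //.
by rewrite scalerDr lactZr ractZr.
Qed.

Definition triAlg : pzAlgType R :=
  PzAlg tri_scaleA tri_scale1 tri_scaleDr tri_scaleDl tri_scaleAl tri_scaleAr.
End Triangular.

Arguments triAlg {R A B} M.

(* Main.v *)
Require Import Defs.
From HB Require Import structures.
From mathcomp Require Import all_boot all_algebra.

Set Implicit Arguments.
Unset Strict Implicit.
Unset Printing Implicit Defensive.

Import GRing.Theory.

Local Open Scope ring_scope.

(** Let psi be LIP on T.  Testing psi on principal left ideals shows that it is
a local left multiplier: psi t = x * t for some x depending on t.  Write
(a, m, b) for the elements of T, e = (1, 0, 0) and f = (0, 0, 1), and let a0 be
the upper left entry of psi e.  The three entries are treated in turn.

On the corner (0, 0, b), the two possibly nonzero entries of psi (0, 0, b) are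
local left multipliers from B into M and from B into B, so both hypotheses on B
apply and psi (0, 0, b) = psi f * (0, 0, b) ([psi_lr_corner]).

For the entry m, the identity psi (1, m, 0) = x * (1, m, 0) = (a', a' m, 0)
ties the first two entries together: the first must be a0, hence
psi (0, m, 0) = (0, a0 m, 0) ([psi_ur_corner]).

For the entry a, the same coupling at (a, a n, 0) gives
psi (a, a n, 0) = (a' a, (a' a) n, 0), whose middle entry is already known to
be a0 (a n).  So the upper left entry of psi (a, 0, 0) acts on M as a0 a does,
and faithfulness of M identifies the two ([psi_ul_corner]).

Adding up, psi t = (psi e + psi f) * t = psi 1 * t. *)

Section LIPLocal.
Variables (R : comPzRingType) (C : pzAlgType R) (psi : {linear C -> C}).

(** The principal left ideal C c witnesses one direction; conversely a left
ideal containing c contains every x c. *)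
Lemma LIP_local_left_multiplier : LIP psi <-> local_left_multiplier psi.
Proof.
split=> [lip c | loc J [_ _ Jmul] c Jc]; last first.
  by have [x ->] := loc c; apply: Jmul.
apply: (lip (fun y => exists x, y = x * c)); last by exists 1; rewrite mul1r.
split; first by exists 0; rewrite mul0r.
  by move=> _ _ [x ->] [y ->]; exists (x + y); rewrite mulrDl.
by move=> d _ [x ->]; exists (d * x); rewrite mulrA.
Qed.

End LIPLocal.

Section Actions.
Variables (R : comPzRingType) (A : pzAlgType R).

Lemma lactBl (M : leftModType A) (a b : A) (m : M) :
  lact (a - b) m = lact a m - lact b m.
Proof. by apply/eqP; rewrite eq_sym subr_eq -lactDl subrK. Qed.

Lemma lact_inj (M : leftModType A) :
  (forall a : A, l_ann M a -> a = 0) ->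
  forall a b : A, (forall m : M, lact a m = lact b m) -> a = b.
Proof.
move=> annM0 a b eq_ab; apply/eqP; rewrite -subr_eq0; apply/eqP/annM0 => m.
by rewrite lactBl eq_ab subrr.
Qed.

Lemma ract0r (M : rightModType A) (m : M) : ract m (0 : A) = 0.
Proof. by apply: (addrI (ract m (0 : A))); rewrite -ractDr !addr0. Qed.

End Actions.

Section TriangularEntries.
Variables (R : comPzRingType) (A B : pzAlgType R) (M : bimodType A B).
Local Notation T := (triAlg M).

(** The entries and the corner inclusion are typed over the algebra [T] rather
than the record [tri M], so that their composites with a linear map [T -> T]
are recognised as linear. *)
Definition ur_entry (t : T) : M := tri_ur (t : tri M).
Definition lr_entry (t : T) : B := tri_lr (t : tri M).
Definition lr_corner (b : B) : T := Tri 0 0 b : tri M.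

Fact ur_entry_linear : linear ur_entry. Proof. by []. Qed.
Fact lr_entry_linear : linear lr_entry. Proof. by []. Qed.
Fact lr_corner_linear : linear lr_corner.
Proof. by move=> r b c; congr Tri; rewrite /= scaler0 addr0. Qed.

HB.instance Definition _ :=
  GRing.isLinear.Build R T M *:%R ur_entry ur_entry_linear.
HB.instance Definition _ :=
  GRing.isLinear.Build R T B *:%R lr_entry lr_entry_linear.
HB.instance Definition _ :=
  GRing.isLinear.Build R B T *:%R lr_corner lr_corner_linear.

Lemma tri_addE (a a' : A) (m m' : M) (b b' : B) :
  (Tri a m b : T) + (Tri a' m' b' : T) = Tri (a + a') (m + m') (b + b').
Proof. by []. Qed.

Lemma tri_mulE (a a' : A) (m m' : M) (b b' : B) :
  (Tri a m b : T) * (Tri a' m' b' : T) =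
  Tri (a * a') (lact a m' + ract m b') (b * b').
Proof. by []. Qed.

Section LocalMultiplier.
Variable psi : {linear T -> T}.
Hypothesis psi_local : local_left_multiplier psi.

Lemma psi_localE (a : A) (m : M) (b : B) :
  exists (a' : A) (m' : M) (b' : B),
    psi (Tri a m b : T) = Tri (a' * a) (lact a' m + ract m' b) (b' * b).
Proof.
by have [[a' m' b'] ->] := psi_local (Tri a m b : T); exists a', m', b'.
Qed.

Lemma psi_top_row (a : A) (m : M) :
  exists a' : A, psi (Tri a m 0 : T) = Tri (a' * a) (lact a' m) 0.
Proof.
have [a' [m' [b' ->]]] := psi_localE a m 0.
by exists a'; rewrite ract0r addr0 mulr0.
Qed.

Lemma psi_lr_corner :
  SLIP B ->
  (forall phi : {linear B -> M},
     local_left_multiplier phi -> left_multiplier phi) ->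
  exists (m0 : M) (b0 : B), forall b : B,
    psi (Tri 0 0 b : T) = Tri 0 (ract m0 b) (b0 * b).
Proof.
move=> slipB local_mult.
pose phiM : {linear B -> M} := ur_entry \o psi \o lr_corner.
pose phiB : {linear B -> B} := lr_entry \o psi \o lr_corner.
have psiE (b : B) : psi (Tri 0 0 b : T) = Tri 0 (phiM b) (phiB b).
  rewrite /phiM /phiB /= /lr_corner.
  have [a' [m' [b' ->]]] := psi_localE 0 0 b.
  by rewrite mulr0.
have locM : local_left_multiplier phiM.
  move=> b; rewrite /phiM /= /lr_corner.
  have [a' [m' [b' ->]]] := psi_localE 0 0 b.
  by exists m'; rewrite /ur_entry /= tri_lact0 add0r.
have locB : local_left_multiplier phiB.
  move=> b; rewrite /phiB /= /lr_corner.
  by have [a' [m' [b' ->]]] := psi_localE 0 0 b; exists b'.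
exists (phiM 1), (phiB 1) => b.
rewrite psiE (local_mult _ locM).
by rewrite (slipB _ ((LIP_local_left_multiplier phiB).2 locB)).
Qed.

(** The value at (1, m, 0) must have a first entry independent of m, since
psi (0, m, 0) vanishes there; this makes the locally chosen multiplier of m
the same for all m. *)
Lemma psi_ur_corner :
  exists a0 : A, forall m : M, psi (Tri 0 m 0 : T) = Tri 0 (lact a0 m) 0.
Proof.
have [a0 psi_e] := psi_top_row 1 0.
rewrite mulr1 tri_lact0 in psi_e.
exists a0 => m.
have [a' psi_1m] := psi_top_row 1 m.
have [c psi_m] := psi_top_row 0 m.
have : psi (Tri 1 m 0 : T) = psi (Tri 1 0 0 : T) + psi (Tri 0 m 0 : T).
  by rewrite -raddfD tri_addE !addr0 add0r.
rewrite psi_1m psi_e psi_m tri_addE !mulr0 mulr1 !addr0 add0r.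
by case=> -> ->.
Qed.

(** The element (a, a n, 0) is chosen because any multiplier of it acts on both
entries through a, which exposes the action of the first entry on n. *)
Lemma psi_ul_corner (a0 : A) :
  (forall a : A, l_ann M a -> a = 0) ->
  (forall m : M, psi (Tri 0 m 0 : T) = Tri 0 (lact a0 m) 0) ->
  forall a : A, psi (Tri a 0 0 : T) = Tri (a0 * a) 0 0.
Proof.
move=> annM0 psi_m a.
have [c psi_a] := psi_top_row a 0.
rewrite psi_a tri_lact0; congr Tri; apply: (lact_inj annM0) => n.
have [a' psi_an] := psi_top_row a (lact a n).
have : psi (Tri a (lact a n) 0 : T) =
       psi (Tri a 0 0 : T) + psi (Tri 0 (lact a n) 0 : T).
  by rewrite -raddfD tri_addE !addr0 add0r.
rewrite psi_an psi_a psi_m tri_addE tri_lact0 !addr0 add0r.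
by rewrite -!lactA; case=> -> ->.
Qed.

End LocalMultiplier.
End TriangularEntries.

Theorem theorem3p8 (R : comPzRingType) (A B : pzAlgType R) (M : bimodType A B)
    (annM0 : forall a : A, l_ann M a <-> a = 0)
    (slipB : SLIP B)
    (local_mult : forall psi : {linear B -> M},
       local_left_multiplier psi -> left_multiplier psi) :
  SLIP (triAlg M).
Proof.
move=> psi /LIP_local_left_multiplier psi_local.
have [m0 [b0 psi_b]] := psi_lr_corner psi_local slipB local_mult.
have [a0 psi_m] := psi_ur_corner psi_local.
have psi_a := psi_ul_corner psi_local (fun a => (annM0 a).1) psi_m.
have psiE (a : A) (m : M) (b : B) : psi (Tri a m b : triAlg M) =
    (Tri a0 m0 b0 : triAlg M) * (Tri a m b : triAlg M).
  have -> : (Tri a m b : triAlg M) =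
      (Tri a 0 0 : triAlg M) + (Tri 0 m 0 : triAlg M) + (Tri 0 0 b : triAlg M).
    by rewrite !tri_addE !addr0 !add0r.
  rewrite !raddfD /= psi_a psi_m psi_b !tri_addE tri_mulE.
  by rewrite !addr0 !add0r.
have psi1 : psi 1 = Tri a0 m0 b0.
  by rewrite (psiE 1 0 1 : psi 1 = _); apply: mulr1.
by case=> a m b; rewrite psi1; exact: psiE.
Qed.
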